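(* Suppose the random Hermitian coupling operator $A_a$ satisfies $\mathbb E\big[(A_a)_{i,j}\overline{(A_a)_{l,k}}\big]=\xi^2\delta_{i,l}\delta_{j,k}$ for all $i,j,k,l\in\{1,\dots,N\}$, where $\xi=\Theta(N^{-1/2})$ is a positive constant. Then for every $\rho\in\mathcal B(\mathcal H)$, $$\mathbb E_a[\mathcal L_{K_a}(\rho)]=\sum_{\omega\in B_H}\gamma(\omega)\,\mathbb E_a\Big(A_a(\omega)\rho A_a(\omega)^\dagger-\tfrac12\big\{A_a(\omega)^\dagger A_a(\omega),\rho\big\}\Big);$$ that is, the generator $\bar{\mathcal L}=\mathbb E_a[\mathcal L_{K_a}]$ is a Davies generator.
   Context: $\mathcal H$ is a Hilbert space of dimension $N=2^n$ and $\mathcal B(\mathcal H)$ the space of operators on it. $H\in\mathcal B(\mathcal H)$ is a Hermitian Hamiltonian with eigenvalues $\lambda_1,\dots,\lambda_N$ (with multiplicity) and a corresponding orthonormal eigenbasis $|\psi_1\rangle,\dots,|\psi_N\rangle$; $B_H=\operatorname{spec}(H)-\operatorname{spec}(H)$ is the set of Bohr frequencies. $\beta>0$, and $\gamma$ is a non-negative function with $\gamma(\omega)=e^{-\beta\omega}\gamma(-\omega)$ (KMS condition). $\{A_a\}$ is an ensemble of random Hermitian operators in $\mathcal B(\mathcal H)$, $\mathbb E=\mathbb E_a$ is expectation over the ensemble, and $(A_a)_{i,j}=\langle\psi_i|A_a|\psi_j\rangle$. For $\omega\in B_H$, $A_a(\omega)=\sum_{i,j:\ \lambda_i-\lambda_j=\omega}|\psi_i\rangle\langle\psi_i|A_a|\psi_j\rangle\langle\psi_j|$.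 $f$ is an (integrable) weight function whose Fourier transform $\hat f(\omega)=\int_{-\infty}^\infty f(s)e^{i\omega s}\,ds$ satisfies $\hat f(\omega)=\sqrt{\gamma(\omega)}$ for all $\omega\in B_H$, and $$K_a=\int_{-\infty}^\infty f(s)e^{iHs}A_ae^{-iHs}\,ds=\sum_{i,j=1}^N\hat f(\lambda_i-\lambda_j)|\psi_i\rangle\langle\psi_i|A_a|\psi_j\rangle\langle\psi_j|,$$ $\mathcal L_{K_a}(\rho)=K_a\rho K_a^\dagger-\tfrac12\{K_a^\dagger K_a,\rho\}$. A Davies generator for $H$ is a Lindbladian of the form $\sum_{a}\sum_{\omega\in B_H}\gamma(\omega)\big(A_a(\omega)\rho A_a(\omega)^\dagger-\frac12\{A_a(\omega)^\dagger A_a(\omega),\rho\}\big)$ (here with the sum over $a$ replaced by the expectation over the ensemble), with coupling operators closed under adjoint and $\gamma\ge0$ satisfying the KMS condition. *)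

(* Defs.v *)
From HB Require Import structures.
From mathcomp Require Import all_boot all_order all_algebra.
From mathcomp Require Import sesquilinear spectral.
From mathcomp Require Import complex.
From mathcomp Require Import all_classical all_reals all_analysis.

Set Implicit Arguments.
Unset Strict Implicit.
Unset Printing Implicit Defensive.

Import Order.TTheory GRing.Theory Num.Theory.
Import numFieldNormedType.Exports.

Local Open Scope classical_set_scope.
Local Open Scope ring_scope.
Local Open Scope complex_scope.
Local Open Scope sesquilinear_scope.

(* The library has no integral of complex-valued functions: integrability and
   integral are taken on real and imaginary parts, and entrywise for matrices.
   An expectation is the integral against a probability measure. *)
Section ComplexIntegral.
Context (R : realType) (d : measure_display) (T : measurableType d).
Variable mu : {measure set T -> \bar R}.

Definition cintegrable (f : T -> R[i]) : Prop :=
  mu.-integrable setT (fun x => (complex.Re (f x))%:E) /\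
  mu.-integrable setT (fun x => (complex.Im (f x))%:E).

Definition cintegral (f : T -> R[i]) : R[i] :=
  Rintegral mu setT (fun x => complex.Re (f x)) +i*
  Rintegral mu setT (fun x => complex.Im (f x)).

Definition mxintegrable m n (F : T -> 'M[R[i]]_(m, n)) : Prop :=
  forall i j, cintegrable (fun x => F x i j).

Definition mxintegral m n (F : T -> 'M[R[i]]_(m, n)) : 'M[R[i]]_(m, n) :=
  \matrix_(i, j) cintegral (fun x => F x i j).

End ComplexIntegral.

Section Operators.
Context (R : realType) (N : nat).
Implicit Types (H A K rho : 'M[R[i]]_N) (lam : 'I_N -> R)
  (psi : 'I_N -> 'cV[R[i]]_N) (f : R -> R[i]).

(* Power series of the exponential; the limit is taken on the real and
   imaginary parts of each entry. *)
Definition expmx_partial A (m : nat) : 'M[R[i]]_N :=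
  \sum_(0 <= k < m) (k`!%:R)^-1 *: A ^+ k.

Definition expmx A : 'M[R[i]]_N :=
  \matrix_(i, j)
    (limn (fun m => complex.Re (expmx_partial A m i j)) +i*
     limn (fun m => complex.Im (expmx_partial A m i j))).

Definition orthonormal_eigenbasis H lam psi : Prop :=
  (forall j, H *m psi j = (lam j)%:C *: psi j) /\
  (forall i j, ((psi i) ^t* *m psi j) 0 0 = (i == j)%:R).

Definition spec H : set R := [set l | eigenvalue H l%:C].

Definition bohr H : set R :=
  [set w | exists l m, [/\ spec H l, spec H m & w = l - m]].

(* <psi_i| A |psi_j> *)
Definition matelt psi A (i j : 'I_N) : R[i] :=
  ((psi i) ^t* *m A *m psi j) 0 0.

Definition bohr_component lam psi (w : R) A : 'M[R[i]]_N :=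
  \sum_i \sum_(j | lam i - lam j == w)
    matelt psi A i j *: (psi i *m (psi j) ^t*).

Definition fourier f (w : R) : R[i] :=
  cintegral (@lebesgue_measure R)
    (fun s : R => f s * (cos (w * s) +i* sin (w * s))).

Definition filtered H f A : 'M[R[i]]_N :=
  mxintegral (@lebesgue_measure R)
    (fun s : R => f s *:
      (expmx ((0 +i* s) *: H) *m A *m expmx ((0 -i* s) *: H))).

Definition dissipator K rho : 'M[R[i]]_N :=
  K *m rho *m K ^t* -
  2^-1 *: (K ^t* *m K *m rho + rho *m (K ^t* *m K)).

Definition KMS (beta : R) (gamma : R -> R) : Prop :=
  forall w, gamma w = expR (- beta * w) * gamma (- w).

Definition random_operator d (T : measurableType d) (A : T -> 'M[R[i]]_N) :
    Prop :=
  forall i j, measurable_fun setT (fun a => complex.Re (A a i j)) /\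
              measurable_fun setT (fun a => complex.Im (A a i j)).

Definition finite_second_moments d (T : measurableType d)
    (P : probability T R) (A : T -> 'M[R[i]]_N) : Prop :=
  forall i j k l, cintegrable P (fun a => A a i j * (A a l k)^*).

(* For an ensemble weighted by a probability measure, closure under adjoint
   has to respect the weights: a |-> a^dagger is realised by a
   measure-preserving map of the index space. *)
Definition adjoint_closed d (T : measurableType d)
    (P : probability T R) (A : T -> 'M[R[i]]_N) : Prop :=
  exists s : T -> T,
    [/\ measurable_fun setT s,
        forall X, measurable X -> P (s @^-1` X) = P X &
        forall a, A (s a) = (A a) ^t*].

Definition davies H lam psi d (T : measurableType d) (P : probability T R)
    (A : T -> 'M[R[i]]_N) (gamma : R -> R) rho : 'M[R[i]]_N :=
  \sum_(w \in bohr H) (gamma w)%:C *: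
    mxintegral P (fun a => dissipator (bohr_component lam psi w (A a)) rho).

Definition is_davies_generator (beta : R) H lam psi
    (L : 'M[R[i]]_N -> 'M[R[i]]_N) : Prop :=
  exists (d : measure_display) (T : measurableType d) (P : probability T R)
         (A : T -> 'M[R[i]]_N) (gamma : R -> R),
    [/\ random_operator A, finite_second_moments P A & adjoint_closed P A] /\
    [/\ forall w, 0 <= gamma w, KMS beta gamma &
        forall rho, L rho = davies H lam psi P A gamma rho].

End Operators.

(* Main.v *)
(** In the eigenbasis of [H], both the filtered operator [K_a] and the Bohr
    components [A_a(w)] are entrywise multiples [c_ij (A_a)_ij] of [A_a], with
    [c_ij = sqrt (gamma (lam_i - lam_j))] and [c_ij = 1] if [lam_i - lam_j = w],
    [0] otherwise.  A dissipator is sesquilinear in its jump operator, so the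
    covariance hypothesis kills all cross terms and leaves
    [xi^2 * \sum_ij |c_ij|^2 D[|psi_i><psi_j|]]; since
    [gamma (lam_i - lam_j)] is the [gamma]-weighted sum over [w] of the
    indicators [lam_i - lam_j = w], the two sides agree. *)

Require Import Defs.
From HB Require Import structures.
From mathcomp Require Import all_boot all_order all_algebra.
From mathcomp Require Import sesquilinear spectral.
From mathcomp Require Import complex.
From mathcomp Require Import all_classical all_reals all_analysis.

Set Implicit Arguments.
Unset Strict Implicit.
Unset Printing Implicit Defensive.

Import Order.TTheory GRing.Theory Num.Theory.
Import numFieldNormedType.Exports.

Local Open Scope classical_set_scope.
Local Open Scope ring_scope.
Local Open Scope complex_scope.
Local Open Scope sesquilinear_scope.

(** * Integration of complex-valued and matrix-valued functions *)

Lemma ReM (R : realType) (x y : R[i]) :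
  complex.Re (x * y) =
  complex.Re x * complex.Re y - complex.Im x * complex.Im y.
Proof. by case: x; case: y. Qed.

Lemma ImM (R : realType) (x y : R[i]) :
  complex.Im (x * y) =
  complex.Re x * complex.Im y + complex.Im x * complex.Re y.
Proof. by case: x; case: y. Qed.

Section ComplexIntegralTheory.
Context (R : realType) (d : measure_display) (T : measurableType d).
Variable mu : {measure set T -> \bar R}.
Implicit Types (f g : T -> R[i]).

Lemma cintegrable0 : cintegrable mu (fun=> 0).
Proof. by split; apply: integrable0. Qed.

Lemma cintegrableD f g : cintegrable mu f -> cintegrable mu g ->
  cintegrable mu (fun x => f x + g x).
Proof.
move=> [fr fi] [gr gi]; split.
  apply: eq_integrable (integrableD _ fr gr) => //= x _.
  by rewrite raddfD.
apply: eq_integrable (integrableD _ fi gi) => //= x _.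
by rewrite raddfD.
Qed.

Lemma cintegrableZl (c : R[i]) f : cintegrable mu f ->
  cintegrable mu (fun x => c * f x).
Proof.
move=> [fr fi]; split.
  apply: eq_integrable (integrableB _ (integrableZl _ (complex.Re c) fr)
    (integrableZl _ (complex.Im c) fi)) => //= x _.
  by rewrite ReM.
apply: eq_integrable (integrableD _ (integrableZl _ (complex.Re c) fi)
  (integrableZl _ (complex.Im c) fr)) => //= x _.
by rewrite ImM.
Qed.

Lemma cintegralD f g : cintegrable mu f -> cintegrable mu g ->
  cintegral mu (fun x => f x + g x) = cintegral mu f + cintegral mu g.
Proof.
move=> [fr fi] [gr gi]; rewrite /cintegral; apply/eqP.
rewrite eq_complex /=; apply/andP; split; apply/eqP;
  rewrite -RintegralD //; apply: eq_Rintegral => x _; exact: raddfD.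
Qed.

Lemma cintegralZl (c : R[i]) f : cintegrable mu f ->
  cintegral mu (fun x => c * f x) = c * cintegral mu f.
Proof.
move=> [fr fi]; rewrite /cintegral; apply/eqP.
rewrite eq_complex ReM ImM /=; apply/andP; split; apply/eqP.
  rewrite -!RintegralZl // -RintegralB //; last 2 first.
  - exact: (integrableZl _ (complex.Re c) fr).
  - exact: (integrableZl _ (complex.Im c) fi).
  by apply: eq_Rintegral => x _; rewrite ReM.
rewrite -!RintegralZl // -RintegralD //; last 2 first.
- exact: (integrableZl _ (complex.Re c) fi).
- exact: (integrableZl _ (complex.Im c) fr).
by apply: eq_Rintegral => x _; rewrite ImM.
Qed.

Lemma cintegrable_sum (J : Type) (r : seq J) (F : J -> T -> R[i]) :
  (forall j, cintegrable mu (F j)) ->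
  cintegrable mu (fun x => \sum_(j <- r) F j x).
Proof.
move=> Fi; elim: r => [|j r IH].
  under eq_fun do rewrite big_nil; exact: cintegrable0.
by under eq_fun do rewrite big_cons; exact: cintegrableD.
Qed.

Lemma cintegral_sum (J : Type) (r : seq J) (F : J -> T -> R[i]) :
  (forall j, cintegrable mu (F j)) ->
  cintegral mu (fun x => \sum_(j <- r) F j x) =
  \sum_(j <- r) cintegral mu (F j).
Proof.
move=> Fi; elim: r => [|j r IH].
  under eq_fun do rewrite big_nil.
  by rewrite big_nil /cintegral /= Rintegral_cst // mul0r.
under eq_fun do rewrite big_cons.
rewrite cintegralD // ?IH ?big_cons //; exact: cintegrable_sum.
Qed.

(** Fixed matrices with integrable scalar coefficients: every matrix integral below, over the
    ensemble or over time, is brought to this shape. *)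
Lemma mxintegrable_sum (J : Type) (r : seq J) m n (F : J -> T -> R[i])
    (M : J -> 'M[R[i]]_(m, n)) :
  (forall j, cintegrable mu (F j)) ->
  mxintegrable mu (fun x => \sum_(j <- r) F j x *: M j).
Proof.
move=> Fi p q; have -> : (fun x => (\sum_(j <- r) F j x *: M j) p q) =
    (fun x => \sum_(j <- r) M j p q * F j x).
  apply/funext => x; rewrite summxE; apply: eq_bigr => j _.
  by rewrite mxE mulrC.
by apply: cintegrable_sum => j; exact: cintegrableZl.
Qed.

Lemma mxintegral_sum (J : Type) (r : seq J) m n (F : J -> T -> R[i])
    (M : J -> 'M[R[i]]_(m, n)) :
  (forall j, cintegrable mu (F j)) ->
  mxintegral mu (fun x => \sum_(j <- r) F j x *: M j) =
  \sum_(j <- r) cintegral mu (F j) *: M j.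
Proof.
move=> Fi; apply/matrixP => p q; rewrite mxE summxE.
have -> : (fun x => (\sum_(j <- r) F j x *: M j) p q) =
    (fun x => \sum_(j <- r) M j p q * F j x).
  apply/funext => x; rewrite summxE; apply: eq_bigr => j _.
  by rewrite mxE mulrC.
rewrite cintegral_sum => [|j]; last exact: cintegrableZl.
by apply: eq_bigr => j _; rewrite cintegralZl // mxE mulrC.
Qed.

(** Serves the Fourier integrals: with [u] and [v] a cosine and a sine, the factor is the phase that
    multiplies the weight function. The real and imaginary parts of the product are combinations of
    integrable functions times bounded measurable ones. *)
Lemma cintegrable_bounded f (u v : T -> R) : cintegrable mu f ->
  measurable_fun setT u -> measurable_fun setT v ->
  (forall x, `|u x| <= 1) -> (forall x, `|v x| <= 1) ->
  cintegrable mu (fun x => f x * (u x +i* v x)).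
Proof.
move=> [fr fi] mu_ mv bu bv.
have bd (h : T -> R) : (forall x, `|h x| <= 1) -> [bounded h x | x in setT].
  move=> hb; exists 1; split => // M ltM x _.
  by apply: le_trans (hb x) (ltW ltM).
split.
  apply: eq_integrable (integrableB _ (integrableMl _ fr mu_ (bd _ bu))
    (integrableMl _ fi mv (bd _ bv))) => //= x _.
  by rewrite ReM.
apply: eq_integrable (integrableD _ (integrableMl _ fr mv (bd _ bv))
  (integrableMl _ fi mu_ (bd _ bu))) => //= x _.
by rewrite ImM.
Qed.

End ComplexIntegralTheory.

(** * Conjugate transposes *)

Section Adjoint.
Context (R : realType).

Lemma adjmxK m n (A : 'M[R[i]]_(m, n)) : A^t*^t* = A.
Proof. by apply/matrixP => i j; rewrite !mxE conjCK. Qed.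

Lemma adjmx_sum (J : Type) (r : seq J) m n (F : J -> 'M[R[i]]_(m, n)) :
  (\sum_(j <- r) F j)^t* = \sum_(j <- r) (F j)^t*.
Proof. by rewrite raddf_sum raddf_sum. Qed.

Lemma adjmxZ m n (c : R[i]) (A : 'M[R[i]]_(m, n)) :
  (c *: A)^t* = Num.conj c *: A^t*.
Proof. by apply/matrixP => i j; rewrite !mxE rmorphM. Qed.

End Adjoint.

(** * Dissipators of linear combinations and their expectations *)

Section Dissipator.
Context (R : realType) (N : nat).
Implicit Types (K L rho : 'M[R[i]]_N).

(** Polarisation of [dissipator]: linear in [K], conjugate-linear in [L], and convertible to
    [dissipator K rho] when [L] is [K]. *)
Definition sesqui_dissipator K L rho : 'M[R[i]]_N :=
  K *m rho *m L ^t* -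
  2^-1 *: (L ^t* *m K *m rho + rho *m (L ^t* *m K)).

Lemma dissipator_sum (J : finType) (x : J -> R[i]) (E : J -> 'M[R[i]]_N) rho :
  dissipator (\sum_p x p *: E p) rho =
  \sum_(pq : J * J) (x pq.1 * Num.conj (x pq.2)) *:
    sesqui_dissipator (E pq.1) (E pq.2) rho.
Proof.
have eKL : (\sum_p x p *: E p)^t* *m (\sum_p x p *: E p) =
    \sum_(pq : J * J) (x pq.1 * Num.conj (x pq.2)) *:
      ((E pq.2)^t* *m E pq.1).
  rewrite adjmx_sum mulmx_sumr -(pair_bigA _ (fun p q =>
    (x p * Num.conj (x q)) *: ((E q)^t* *m E p))) /=.
  apply: eq_bigr => p _; rewrite mulmx_suml; apply: eq_bigr => q _.
  by rewrite adjmxZ -scalemxAl -scalemxAr scalerA mulrC.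
rewrite /dissipator eKL adjmx_sum !mulmx_suml.
under eq_bigr => p _ do rewrite mulmx_sumr.
rewrite (pair_bigA _ (fun p q =>
  x p *: E p *m rho *m (x q *: E q)^t*)) /=.
rewrite mulmx_sumr -big_split /= scaler_sumr -sumrB; apply: eq_bigr => pq _.
rewrite /sesqui_dissipator adjmxZ -!scalemxAl -!scalemxAr !scalerA.
by rewrite -scalerDr scalerA scalerBr scalerA [2^-1 * _]mulrC.
Qed.

Context (d : measure_display) (T : measurableType d) (P : probability T R).

(** The second-moment matrix of the random coefficients [x] is [s] times the identity, so only the
    pairs [p = q] survive in the sesquilinear expansion. The deterministic weights [c] are kept
    general because the lemma serves both the filtered operator and the Bohr components. *)
Lemma mxintegral_dissipator (J : finType) (s : R[i]) (c : J -> R[i])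
    (x : T -> J -> R[i]) (E : J -> 'M[R[i]]_N) (K : T -> 'M[R[i]]_N) rho :
  (forall a, K a = \sum_p (c p * x a p) *: E p) ->
  (forall p q, cintegrable P (fun a => x a p * Num.conj (x a q)) /\
     cintegral P (fun a => x a p * Num.conj (x a q)) = s * (p == q)%:R) ->
  mxintegrable P (fun a => dissipator (K a) rho) /\
  mxintegral P (fun a => dissipator (K a) rho) =
    \sum_p (s * (c p * Num.conj (c p))) *: dissipator (E p) rho.
Proof.
move=> KE moments; have -> : (fun a => dissipator (K a) rho) =
    (fun a => \sum_(pq : J * J) (c pq.1 * Num.conj (c pq.2) *
      (x a pq.1 * Num.conj (x a pq.2))) *:
      sesqui_dissipator (E pq.1) (E pq.2) rho).
  apply/funext => a; rewrite KE dissipator_sum; apply: eq_bigr => pq _.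
  by rewrite rmorphM mulrACA.
have int pq : cintegrable P (fun a => c pq.1 * Num.conj (c pq.2) *
    (x a pq.1 * Num.conj (x a pq.2))).
  by apply: cintegrableZl; apply: (moments _ _).1.
split; first exact: mxintegrable_sum.
rewrite mxintegral_sum // -(pair_bigA _ (fun p q =>
  cintegral P (fun a => c p * Num.conj (c q) * (x a p * Num.conj (x a q)))
    *: sesqui_dissipator (E p) (E q) rho)) /=.
apply: eq_bigr => p _; rewrite (bigD1 p) //= big1 ?addr0 => [|q neq_qp].
  rewrite cintegralZl; last exact: (moments _ _).1.
  by rewrite (moments _ _).2 eqxx mulr1 mulrC.
rewrite cintegralZl; last exact: (moments _ _).1.
by rewrite (moments _ _).2 eq_sym (negPf neq_qp) !mulr0 scale0r.
Qed.

End Dissipator.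

(** * Expansion in the eigenbasis, and the Bohr frequencies *)

Section Eigenbasis.
Context (R : realType) (N : nat).
Implicit Types (H A K rho : 'M[R[i]]_N) (lam : 'I_N -> R).
Variable psi : 'I_N -> 'cV[R[i]]_N.

Definition ketbra (i j : 'I_N) : 'M[R[i]]_N := psi i *m (psi j)^t*.

Lemma ketbra_sandwich A i j :
  ketbra i i *m A *m ketbra j j = matelt psi A i j *: ketbra i j.
Proof.
have -> : ketbra i i *m A *m ketbra j j =
    psi i *m ((psi i)^t* *m A *m psi j) *m (psi j)^t*.
  by rewrite /ketbra !mulmxA.
by rewrite [(psi i)^t* *m A *m psi j]mx11_scalar mul_mx_scalar -scalemxAl.
Qed.

(** The constraint on the frequency becomes a 0/1 weight, which gives the form required by
    [mxintegral_dissipator]. *)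
Lemma bohr_componentE lam w A :
  bohr_component lam psi w A =
  \sum_(p : 'I_N * 'I_N) ((lam p.1 - lam p.2 == w)%:R * matelt psi A p.1 p.2)
    *: ketbra p.1 p.2.
Proof.
rewrite /bohr_component -(pair_bigA _ (fun i j =>
  ((lam i - lam j == w)%:R * matelt psi A i j) *: ketbra i j)) /=.
apply: eq_bigr => i _; rewrite big_mkcond /=; apply: eq_bigr => j _.
by case: eqP => _; rewrite ?mul1r // mul0r scale0r.
Qed.

Hypothesis psi_on : forall i j, ((psi i)^t* *m psi j) 0 0 = (i == j)%:R.

Lemma sum_ketbra : \sum_i ketbra i i = 1%:M.
Proof.
(* The columns of [U] are the vectors [psi j]. Orthonormality says that [U^t*] is a left inverse; as
   [U] is square, it is also a right inverse, and this is the completeness relation. *)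
pose U : 'M[R[i]]_N := \matrix_(p, j) psi j p 0.
have UU : U^t* *m U = 1%:M.
  apply/matrixP => i j; rewrite !mxE -psi_on mxE.
  by apply: eq_bigr => p _; rewrite !mxE.
rewrite -(mulmx1C UU); apply/matrixP => p q; rewrite summxE !mxE.
by apply: eq_bigr => i _; rewrite !mxE big_ord1 !mxE.
Qed.

Lemma matelt_sum A :
  A = \sum_(p : 'I_N * 'I_N) matelt psi A p.1 p.2 *: ketbra p.1 p.2.
Proof.
rewrite -[LHS]mul1mx -[LHS]mulmx1 -sum_ketbra mulmx_suml mulmx_suml.
under eq_bigr do rewrite mulmx_sumr.
rewrite pair_bigA /=; apply: eq_bigr => p _; exact: ketbra_sandwich.
Qed.

Variables (H : 'M[R[i]]_N) (lam : 'I_N -> R).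
Hypothesis H_psi : forall j, H *m psi j = (lam j)%:C *: psi j.

Lemma spectral_decomposition : H = \sum_i (lam i)%:C *: ketbra i i.
Proof.
rewrite -[LHS]mulmx1 -sum_ketbra mulmx_sumr; apply: eq_bigr => i _.
by rewrite mulmxA H_psi -scalemxAl.
Qed.

(** The point is that the spectrum consists exactly of the values of [lam]. Since [eigenvalue]
    refers to row eigenvectors, one direction pairs such a row with the columns [psi j], and the
    other uses the bra of [psi i] as a left eigenvector. *)
Lemma bohrP w : bohr H w <-> exists i j, w = lam i - lam j.
Proof.
have adj_eig j (l : R) (v : 'rV[R[i]]_N) : v *m H = l%:C *: v ->
    l%:C * (v *m psi j) 0 0 = (lam j)%:C * (v *m psi j) 0 0.
  move=> vH; have : (v *m H *m psi j) 0 0 = (v *m (H *m psi j)) 0 0.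
    by rewrite mulmxA.
  by rewrite vH H_psi -scalemxAl -scalemxAr !mxE.
have psi_neq0 j : psi j != 0.
  apply/eqP => psi0; have := psi_on j j.
  by rewrite psi0 mulmx0 mxE eqxx => /eqP; rewrite eq_sym oner_eq0.
have specP l : spec H l <-> exists i, l = lam i.
  split=> [/eigenvalueP[v vH v0]|[i ->]].
    (* If [l] differed from every [lam i], then [adj_eig] would make all the coefficients
       [v *m psi i] vanish, and [v] would be zero by completeness. *)
    apply: contrapT => /forallNP nl; case/eqP: v0.
    rewrite -[v]mulmx1 -sum_ketbra mulmx_sumr big1 // => i _.
    rewrite /ketbra mulmxA [v *m _]mx11_scalar.
    move: (adj_eig i l v vH) => /eqP; rewrite -subr_eq0 -mulrBl mulf_eq0.
    case/orP => [|/eqP ->]; last by rewrite mul_scalar_mx scale0r.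
    by rewrite subr_eq0 => /eqP[] /nl.
  apply/eigenvalueP; exists ((psi i)^t* ); last first.
    apply: contraNneq (psi_neq0 i) => psi0.
    by rewrite -[psi i]adjmxK psi0 trmx0 map_mx0.
  rewrite spectral_decomposition mulmx_sumr (bigD1 i) //= big1 ?addr0.
    by rewrite -scalemxAr mulmxA [_ *m psi i]mx11_scalar psi_on eqxx mul1mx.
  move=> k; rewrite eq_sym => /negPf neq_ik.
  by rewrite -scalemxAr mulmxA [_ *m psi k]mx11_scalar psi_on neq_ik
    mul_scalar_mx scale0r scaler0.
split=> [[l [m [/specP[i ->] /specP[j ->] ->]]]|[i [j ->]]].
  by exists i, j.
by exists (lam i), (lam j); split => //; apply/specP; [exists i|exists j].
Qed.

(** Turns the sum over a set of reals into one over a list, where sums can be exchanged; [undup]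
    counts a frequency shared by several pairs only once. *)
Lemma bohr_sum (V : lmodType R[i]) (F : R -> V) :
  \sum_(w \in bohr H) F w =
  \sum_(w <- undup [seq lam p.1 - lam p.2 | p : 'I_N * 'I_N]) F w.
Proof.
rewrite [RHS]fsbig_seq ?undup_uniq //.
suff -> : bohr H = [set` undup [seq lam p.1 - lam p.2 | p : 'I_N * 'I_N]] by [].
apply/seteqP; split=> w /=; rewrite mem_undup.
  by move=> /bohrP[i [j ->]]; apply/mapP; exists (i, j); rewrite ?mem_enum.
by move=> /mapP[[i j] _ ->]; apply/bohrP; exists i, j.
Qed.

End Eigenbasis.

(** * Unitary evolution and the filtered operator *)

Section FilteredOperator.
Context (R : realType).

(** Even powers of the imaginary unit are real and odd ones imaginary. The parity factors and halved
    exponents are written as in [cos_coeff] and [sin_coeff]. *)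
Lemma expCI (x : R) k :
  (0 +i* x) ^+ k = ((~~ odd k)%:R * (-1) ^+ k./2 * x ^+ k) +i*
                   ((odd k)%:R * (-1) ^+ k.-1./2 * x ^+ k).
Proof.
elim: k => [|k IH].
  by rewrite !expr0 !mulr1; apply/eqP; rewrite eq_complex /= !eqxx.
rewrite exprSr IH; apply/eqP; rewrite eq_complex ReM ImM /= uphalf_half.
case: (boolP (odd k)) => ok /=; apply/andP; split; apply/eqP.
- have -> : k.-1./2 = k./2.
    by rewrite -[in LHS](odd_double_half k) ok /= doubleK.
  by rewrite !mul0r sub0r !mul1r add1n exprS exprSr mulN1r !mulNr mulrA.
- by rewrite !mul0r mulr0 addr0.
- by rewrite !mul0r mulr0 subr0.
- by rewrite !mul0r addr0 !mul1r exprSr mulrA.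
Qed.

Lemma sum_expCI (x : R) m :
  \sum_(0 <= k < m) (k`!%:R)^-1 * (0 +i* x) ^+ k =
  series (cos_coeff x) m +i* series (sin_coeff x) m.
Proof.
apply/eqP; rewrite eq_complex !raddf_sum /=.
(* The inverse factorial is a real scalar, so it acts separately on real and imaginary parts. *)
have fE k : ((k`!%:R)^-1 : R[i]) = (k`!%:R^-1 : R)%:C.
  by rewrite fmorphV rmorph_nat.
apply/andP; split; apply/eqP; apply: eq_bigr => k _;
  rewrite expCI fE ?ReM ?ImM /= mul0r ?subr0 ?addr0 mulrC //.
Qed.

Definition phase (x : R) : R[i] := cos x +i* sin x.

Lemma phaseD (x y : R) : phase (x + y) = phase x * phase y.
Proof.
apply/eqP; rewrite eq_complex ReM ImM /= cosD sinD eqxx /=.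
by rewrite addrC eqxx.
Qed.

Context (N : nat) (psi : 'I_N -> 'cV[R[i]]_N).
Hypothesis psi_on : forall i j, ((psi i)^t* *m psi j) 0 0 = (i == j)%:R.
Variables (H : 'M[R[i]]_N) (lam : 'I_N -> R).
Hypothesis H_psi : forall j, H *m psi j = (lam j)%:C *: psi j.

(** Multiplying by the resolution of the identity lets each power of [H] act on an eigenvector,
    which reduces the matrix series to scalar ones. *)
Lemma expmx_partialE (s : R) m :
  expmx_partial ((0 +i* s) *: H) m =
  \sum_i (series (cos_coeff (s * lam i)) m +i*
          series (sin_coeff (s * lam i)) m) *: ketbra psi i i.
Proof.
rewrite -[LHS]mulmx1 -(sum_ketbra psi_on) mulmx_sumr; apply: eq_bigr => i _.
rewrite -sum_expCI /expmx_partial mulmx_suml scaler_suml.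
apply: eq_bigr => k _; rewrite -scalemxAl -scalerA; congr (_ *: _).
have step : ((0 +i* s) *: H) *m psi i = (0 +i* (s * lam i)) *: psi i.
  rewrite -scalemxAl H_psi scalerA; congr (_ *: _); apply/eqP.
  by rewrite eq_complex ReM ImM /= !mul0r mulr0 subr0 add0r !eqxx.
have stepX : ((0 +i* s) *: H) ^+ k *m psi i =
    (0 +i* (s * lam i)) ^+ k *: psi i.
  elim: k => [|k IH]; first by rewrite !expr0 mul1mx scale1r.
  by rewrite exprSr -mulmxA step -scalemxAr IH scalerA -exprS.
by rewrite /ketbra mulmxA stepX -scalemxAl.
Qed.

Lemma expmxE (s : R) :
  expmx ((0 +i* s) *: H) = \sum_i phase (s * lam i) *: ketbra psi i i.
Proof.
(* Unlocking [cos] and [sin] exposes them as limits of these series, so it remains to know that the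
   series converge. *)
have cvg_cos x : series (cos_coeff x) @ \oo --> (cos x : R).
  by rewrite unlock; exact: is_cvg_series_cos_coeff.
have cvg_sin x : series (sin_coeff x) @ \oo --> (sin x : R).
  by rewrite unlock; exact: is_cvg_series_sin_coeff.
pose S x m : R[i] := series (cos_coeff x) m +i* series (sin_coeff x) m.
(* The entry [c] of a projector is complex, so the real and imaginary parts of the product each mix
   the cosine and sine series. *)
have cvgRe x (c : R[i]) :
    complex.Re (S x m * c) @[m --> \oo] --> complex.Re (phase x * c).
  rewrite ReM; under eq_cvg do rewrite ReM.
  by apply: cvgB; apply: cvgMr_tmp; [exact: cvg_cos|exact: cvg_sin].
have cvgIm x (c : R[i]) :
    complex.Im (S x m * c) @[m --> \oo] --> complex.Im (phase x * c).
  rewrite ImM; under eq_cvg do rewrite ImM.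
  by apply: cvgD; apply: cvgMr_tmp; [exact: cvg_cos|exact: cvg_sin].
apply/matrixP => p q; rewrite mxE summxE; apply/eqP.
rewrite eq_complex !raddf_sum /=; apply/andP; split; apply/eqP;
  apply/cvg_lim => //; under eq_cvg do rewrite expmx_partialE summxE raddf_sum;
  apply: cvg_big => [|i _]; try exact: add_continuous; rewrite mxE;
  under eq_cvg do rewrite mxE.
- exact: cvgRe.
- exact: cvgIm.
Qed.

(** The two exponentials multiply the component of [A] on [ketbra psi i j] by the phase of
    [(lam i - lam j) * s]; integrating this against [f] gives the Fourier transform at the frequency
    [lam i - lam j]. *)
Lemma filteredE (f : R -> R[i]) (A : 'M[R[i]]_N) :
  cintegrable (@lebesgue_measure R) f ->
  filtered H f A = \sum_(p : 'I_N * 'I_N)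
    (fourier f (lam p.1 - lam p.2) * matelt psi A p.1 p.2) *:
      ketbra psi p.1 p.2.
Proof.
move=> f_int; rewrite /filtered.
have -> : (fun s : R => f s *: (expmx ((0 +i* s) *: H) *m A *m
    expmx ((0 -i* s) *: H))) =
    (fun s : R => \sum_(p : 'I_N * 'I_N)
      (f s * (cos ((lam p.1 - lam p.2) * s) +i*
              sin ((lam p.1 - lam p.2) * s))) *:
      (matelt psi A p.1 p.2 *: ketbra psi p.1 p.2)).
  apply/funext => s; rewrite !expmxE mulmx_suml mulmx_suml.
  under eq_bigr do rewrite mulmx_sumr.
  rewrite pair_bigA /= scaler_sumr; apply: eq_bigr => p _.
  rewrite -!scalemxAl -!scalemxAr ketbra_sandwich !scalerA.
  rewrite -!mulrA; congr (_ * _ *: _); rewrite mulrA -phaseD /phase.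
  by rewrite mulNr -mulrBr [s * _]mulrC.
have meas (u : R -> R) w : continuous u ->
    measurable_fun setT (fun s : R => u (w * s)).
  move=> uc; apply: measurable_realfun.continuous_measurable_fun => s.
  apply: continuous_comp; last exact: uc.
  exact: mulrl_continuous.
rewrite mxintegral_sum => [|p].
  by apply: eq_bigr => p _; rewrite scalerA.
apply: cintegrable_bounded => // [||s|s]; [| |exact: cos_max|exact: sin_max].
- by apply: (meas cos); exact: continuous_cos.
- by apply: (meas sin); exact: continuous_sin.
Qed.

End FilteredOperator.

(** * Expectations under the covariance hypothesis *)

Section SecondMoments.
Context (R : realType) (N : nat) (psi : 'I_N -> 'cV[R[i]]_N).
Hypothesis psi_on : forall i j, ((psi i)^t* *m psi j) 0 0 = (i == j)%:R.
Context (d : measure_display) (T : measurableType d) (P : probability T R).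
Variables (A : T -> 'M[R[i]]_N) (s : R[i]).
Hypothesis moments : forall p q : 'I_N * 'I_N,
  let x a (u : 'I_N * 'I_N) := matelt psi (A a) u.1 u.2 in
  cintegrable P (fun a => x a p * Num.conj (x a q)) /\
  cintegral P (fun a => x a p * Num.conj (x a q)) = s * (p == q)%:R.

(** Entries in the standard basis are fixed linear combinations of the matrix elements in the
    eigenbasis, so their products are finite combinations of integrable ones. *)
Lemma finite_second_moments_matelt : finite_second_moments P A.
Proof.
move=> p q r t.
have entry a (i j : 'I_N) : A a i j = \sum_(u : 'I_N * 'I_N)
    matelt psi (A a) u.1 u.2 * ketbra psi u.1 u.2 i j.
  rewrite [in LHS](matelt_sum psi_on (A a)) summxE.
  by apply: eq_bigr => u _; rewrite mxE.
have -> : (fun a => A a p q * Num.conj (A a t r)) =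
    (fun a => \sum_(u : 'I_N * 'I_N) \sum_(v : 'I_N * 'I_N)
      (ketbra psi u.1 u.2 p q * Num.conj (ketbra psi v.1 v.2 t r)) *
      (matelt psi (A a) u.1 u.2 * Num.conj (matelt psi (A a) v.1 v.2))).
  apply/funext => a; rewrite !entry rmorph_sum mulr_suml.
  apply: eq_bigr => u _; rewrite mulr_sumr; apply: eq_bigr => v _.
  by rewrite rmorphM mulrACA mulrC.
apply: cintegrable_sum => u; apply: cintegrable_sum => v.
by apply: cintegrableZl; exact: (moments u v).1.
Qed.

Variables (H : 'M[R[i]]_N) (lam : 'I_N -> R).
Hypothesis H_psi : forall j, H *m psi j = (lam j)%:C *: psi j.

Lemma mxintegrable_bohr_component w rho :
  mxintegrable P (fun a => dissipator (bohr_component lam psi w (A a)) rho).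
Proof.
exact: (mxintegral_dissipator rho
  (fun a => bohr_componentE psi lam w (A a)) moments).1.
Qed.

Lemma mxintegral_davies (gamma : R -> R) (K : T -> 'M[R[i]]_N) rho :
  (forall w, 0 <= gamma w) ->
  (forall a, K a = \sum_(p : 'I_N * 'I_N)
    ((Num.sqrt (gamma (lam p.1 - lam p.2)))%:C * matelt psi (A a) p.1 p.2) *:
      ketbra psi p.1 p.2) ->
  mxintegrable P (fun a => dissipator (K a) rho) /\
  mxintegral P (fun a => dissipator (K a) rho) =
    davies H lam psi P A gamma rho.
Proof.
move=> gamma_ge0 KE.
have [intK ->] := mxintegral_dissipator rho KE moments.
split=> //; rewrite /davies (bohr_sum psi_on H_psi).
under [RHS]eq_bigr => w _ do rewrite (mxintegral_dissipator rho
  (fun a => bohr_componentE psi lam w (A a)) moments).2 scaler_sumr.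
(* With the pair [p] fixed, the only frequency of nonzero weight is [lam p.1 - lam p.2], and it does
   occur in the list. *)
rewrite exchange_big /=; apply: eq_bigr => p _.
rewrite (bigD1_seq (lam p.1 - lam p.2)) ?undup_uniq //=; last first.
  by rewrite mem_undup; apply/mapP; exists p; rewrite ?mem_enum.
rewrite big1 => [|w neq_w]; last first.
  by rewrite eq_sym (negPf neq_w) mul0r mulr0 scale0r scaler0.
rewrite eqxx addr0 scalerA conjC1 !mulr1 mulrC; congr (_ * _ *: _).
(* The remaining weight is [Num.sqrt (gamma _)] times its conjugate; it equals [gamma] because
   [gamma] is non-negative. *)
have conj_real (r : R) : Num.conj r%:C = r%:C by exact: conjc_real.
by rewrite conj_real -rmorphM -expr2 sqr_sqrtr.
Qed.

End SecondMoments.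

Theorem theorem11 (R : realType)
  (xi : nat -> R) (xi_gt0 : forall m, 0 < xi m)
  (xi_Theta : xi =Theta_\oo (fun m : nat => (Num.sqrt ((2 ^ m)%N%:R : R))^-1))
  (n : nat)
  (H : 'M[R[i]]_(2 ^ n)) (H_herm : H \is hermsymmx)
  (lam : 'I_(2 ^ n) -> R) (psi : 'I_(2 ^ n) -> 'cV[R[i]]_(2 ^ n))
  (eigH : orthonormal_eigenbasis H lam psi)
  (beta : R) (beta_gt0 : 0 < beta)
  (gamma : R -> R) (gamma_ge0 : forall w, 0 <= gamma w)
  (gamma_KMS : KMS beta gamma)
  (f : R -> R[i]) (f_int : cintegrable (@lebesgue_measure R) f)
  (f_hat : forall w, bohr H w -> fourier f w = (Num.sqrt (gamma w))%:C)
  (d : measure_display) (T : measurableType d) (P : probability T R)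
  (A : T -> 'M[R[i]]_(2 ^ n)) (A_rand : random_operator A)
  (A_herm : forall a, A a \is hermsymmx)
  (A_moments : forall i j k l,
     cintegrable P (fun a => matelt psi (A a) i j * (matelt psi (A a) l k)^*) /\
     cintegral P (fun a => matelt psi (A a) i j * (matelt psi (A a) l k)^*) =
       (xi n ^+ 2)%:C * (i == l)%:R * (j == k)%:R) :
  (forall rho : 'M[R[i]]_(2 ^ n),
     [/\ mxintegrable P (fun a => dissipator (filtered H f (A a)) rho),
         forall w, bohr H w -> mxintegrable P
           (fun a => dissipator (bohr_component lam psi w (A a)) rho) &
         mxintegral P (fun a => dissipator (filtered H f (A a)) rho) =
         \sum_(w \in bohr H) (gamma w)%:C *:
           mxintegral P
             (fun a => dissipator (bohr_component lam psi w (A a)) rho)]) /\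
  is_davies_generator beta H lam psi
    (fun rho => mxintegral P (fun a => dissipator (filtered H f (A a)) rho)).
Proof.
have [H_psi psi_on] := eigH.
(* Indexed by pairs, the two Kronecker deltas merge into one; the last two indices of [A_moments]
   come in reversed order. *)
have moments p q : cintegrable P (fun a =>
    matelt psi (A a) p.1 p.2 * Num.conj (matelt psi (A a) q.1 q.2)) /\
    cintegral P (fun a =>
      matelt psi (A a) p.1 p.2 * Num.conj (matelt psi (A a) q.1 q.2)) =
    (xi n ^+ 2)%:C * (p == q)%:R.
  have [int ->] := A_moments p.1 p.2 q.2 q.1; split=> //.
  by rewrite -mulrA -natrM mulnb -xpair_eqE -!surjective_pairing.
(* [f_hat] speaks of Bohr frequencies only, and [bohrP] places every eigenvalue difference among
   them. *)
have sqrt_gamma p : fourier f (lam p.1 - lam p.2) =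
    (Num.sqrt (gamma (lam p.1 - lam p.2)))%:C.
  by apply/f_hat/(bohrP psi_on H_psi); exists p.1, p.2.
have filt a : filtered H f (A a) = \sum_(p : 'I_(2 ^ n) * 'I_(2 ^ n))
    ((Num.sqrt (gamma (lam p.1 - lam p.2)))%:C * matelt psi (A a) p.1 p.2) *:
      ketbra psi p.1 p.2.
  rewrite (filteredE psi_on H_psi) //.
  by apply: eq_bigr => p _; rewrite sqrt_gamma.
have davies_int rho := mxintegral_davies psi_on moments H_psi rho gamma_ge0 filt.
split=> [rho|].
  split; [exact: (davies_int rho).1| |exact: (davies_int rho).2].
  by move=> w _; exact: (mxintegrable_bohr_component moments).
(* The same ensemble serves as coupling operators; each [A a] is Hermitian, so the identity map
   realises the closure under adjoint. *)
exists d, T, P, A, gamma; split; split=> //.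
- exact: (finite_second_moments_matelt psi_on moments).
- exists idfun; split=> [|//|a]; first exact: measurable_id.
  have /is_hermitianmxP := A_herm a.
  by rewrite expr0 scale1r.
- by move=> rho; exact: (davies_int rho).2.
Qed.
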